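(* Let $A$ be a dg algebra over a commutative ring $k$. Then two Maurer–Cartan elements of $A$ are strongly homotopic if and only if they are homotopy gauge equivalent.
   Context: A Maurer–Cartan element is $x\in A^1$ with $dx+x^2=0$. For such $x$, $A^{[x]}$ is the right dg $A$-module with underlying graded module $A$ and differential $a\mapsto da+xa$; $x,x'$ are homotopy gauge equivalent if $A^{[x]}$ and $A^{[x']}$ are homotopy equivalent right dg $A$-modules. Let $I$ be the singular simplicial set of $[0,1]$ and $I^*$ its normalized cochain algebra with values in $k$ (Alexander–Whitney product), a pseudo-compact dg algebra $I^*=\varprojlim I^*_\alpha$; $A\otimes I^*$ means the completed tensor product $\varprojlim_\alpha(A\otimes I^*_\alpha)$. $ev_0,ev_1:I^*\to k$ are restriction to the endpoints. Two MC elements $x_0,x_1$ are strongly homotopic if there is an MC element $X\in A\otimes I^*$ with $(\mathrm{id}_A\otimes ev_0)(X)=x_0$ and $(\mathrm{id}_A\otimes ev_1)(X)=x_1$. *)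

(* Defs.v *)
From HB Require Import structures.
From mathcomp Require Import all_boot all_order all_algebra.
From mathcomp Require Import all_classical all_reals all_analysis.
From mathcomp Require Import Rstruct Rstruct_topology.
Set Implicit Arguments. Unset Strict Implicit. Unset Printing Implicit Defensive.
Import Order.TTheory GRing.Theory Num.Theory.
Local Open Scope classical_set_scope.
Local Open Scope ring_scope.

(* castd i j a transports a : F i to F j when i = j (and is 0 otherwise; *)
(* every use below is at provably equal degrees).                       *)
Definition castd (k : pzRingType) (F : int -> lmodType k) (i j : int) (a : F i) : F j :=
  match @eqP _ i j with
  | ReflectT e => eq_rect i (fun z => F z) a j e
  | ReflectF _ => 0
  end.
Arguments castd {k F i j}.

Record dga (k : comPzRingType) := DGA {
  dgA :> int -> lmodType k;
  dgmul : forall i j, dgA i -> dgA j -> dgA (i + j);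
  dgone : dgA 0;
  dgd : forall i, dgA i -> dgA (i + 1);
  dgmul_linl : forall i j (r : k) (a a' : dgA i) (b : dgA j),
      dgmul (r *: a + a') b = r *: dgmul a b + dgmul a' b;
  dgmul_linr : forall i j (r : k) (a : dgA i) (b b' : dgA j),
      dgmul a (r *: b + b') = r *: dgmul a b + dgmul a b';
  dgmulA : forall i j l (a : dgA i) (b : dgA j) (c : dgA l),
      castd (dgmul a (dgmul b c)) = dgmul (dgmul a b) c;
  dgmul1l : forall i (a : dgA i), castd (dgmul dgone a) = a;
  dgmul1r : forall i (a : dgA i), castd (dgmul a dgone) = a;
  dgd_lin : forall i (r : k) (a b : dgA i), dgd (r *: a + b) = r *: dgd a + dgd b;
  dgdd : forall i (a : dgA i), dgd (dgd a) = 0;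
  dgd_Leibniz : forall i j (a : dgA i) (b : dgA j),
      dgd (dgmul a b) =
        castd (dgmul (dgd a) b) + (-1) ^+ `|i|%N *: castd (dgmul a (dgd b))
}.
Arguments dgmul {k} _ {i j}.
Arguments dgd {k} _ {i}.
Arguments dgone {k} _.

Section MC.
Variables (k : comPzRingType) (A : dga k).

Definition is_MC (x : A 1) : Prop := dgd A x + dgmul A x x = 0.

(* Homotopy gauge equivalence.  A^[x] : underlying graded module A,    *)
(* right action by multiplication, differential a |-> da + xa.         *)
Definition twd (x : A 1) (n : int) (a : A n) : A (n + 1) :=
  dgd A a + castd (dgmul A x a).

Definition dgmod_hom (x y : A 1) (f : forall n, A n -> A n) : Prop :=
  (forall n (r : k) (a b : A n), f n (r *: a + b) = r *: f n a + f n b) /\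
  (forall n m (a : A n) (b : A m), f (n + m) (dgmul A a b) = dgmul A (f n a) b) /\
  (forall n (a : A n), f (n + 1) (twd x a) = twd y (f n a)).

Definition dgmod_htpy (x : A 1) (u : forall n, A n -> A n)
    (h : forall n, A n -> A (n - 1)) : Prop :=
  (forall n (r : k) (a b : A n), h n (r *: a + b) = r *: h n a + h n b) /\
  (forall n m (a : A n) (b : A m),
      h (n + m) (dgmul A a b) = castd (dgmul A (h n a) b)) /\
  (forall n (a : A n),
      u n a - a = castd (twd x (h n a)) + castd (h (n + 1) (twd x a))).

Definition homotopy_gauge_equivalent (x x' : A 1) : Prop :=
  exists (f g : forall n, A n -> A n) (h h' : forall n, A n -> A (n - 1)),
    [/\ dgmod_hom x x' f, dgmod_hom x' x g,
        dgmod_htpy x (fun n a => g n (f n a)) h &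
        dgmod_htpy x' (fun n a => f n (g n a)) h'].

End MC.

(* The singular simplicial set I of [0,1].                              *)
(* An n-simplex is a continuous map Delta^n -> [0,1]; we represent it   *)
(* by its extension by 0 to all of R^{n+1} (rows 'rV_(n.+1)), so that   *)
(* simplices are determined by their values on Delta^n.                 *)
Notation RR := Rdefinitions.R.

Definition stdsimplex (n : nat) : set 'rV[RR]_(n.+1) :=
  [set t | (forall j, 0 <= t ord0 j) /\ \sum_j t ord0 j = 1].

Arguments stdsimplex : clear implicits.

Definition restr (n : nat) (f : 'rV[RR]_(n.+1) -> RR) : 'rV[RR]_(n.+1) -> RR :=
  fun t => if `[< stdsimplex n t >] then f t else 0.

Definition is_sing (n : nat) (s : 'rV[RR]_(n.+1) -> RR) : Prop :=
  [/\ {within stdsimplex n, continuous s},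
      (forall t, stdsimplex n t -> 0 <= s t <= 1) &
      (forall t, ~ stdsimplex n t -> s t = 0)].

Definition coface (m : nat) (i : 'I_(m.+2)) (t : 'rV[RR]_(m.+1)) : 'rV[RR]_(m.+2) :=
  \row_(j < m.+2) (if (j < i)%N then t ord0 (inord j)
                   else if (j == i :> nat) then 0 else t ord0 (inord j.-1)).

Definition codeg (m : nat) (j : 'I_(m.+1)) (t : 'rV[RR]_(m.+2)) : 'rV[RR]_(m.+1) :=
  \row_(l < m.+1) (if (l < j)%N then t ord0 (inord l)
                   else if (l == j :> nat) then t ord0 (inord l) + t ord0 (inord l.+1)
                   else t ord0 (inord l.+1)).

Definition face (m : nat) (i : 'I_(m.+2)) (s : 'rV[RR]_(m.+2) -> RR) : 'rV[RR]_(m.+1) -> RR :=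
  restr (s \o coface i).

Definition degenerate (m : nat) (s : 'rV[RR]_(m.+2) -> RR) : Prop :=
  exists (j : 'I_(m.+1)) (tau : 'rV[RR]_(m.+1) -> RR),
    is_sing tau /\ s = restr (tau \o codeg j).

Definition front (n p : nat) (s : 'rV[RR]_(n.+1) -> RR) : 'rV[RR]_(p.+1) -> RR :=
  restr (fun t : 'rV[RR]_(p.+1) =>
    s (\row_(j < n.+1) (if (j <= p)%N then t ord0 (inord j) else 0))).
Definition back (n q : nat) (s : 'rV[RR]_(n.+1) -> RR) : 'rV[RR]_(q.+1) -> RR :=
  restr (fun t : 'rV[RR]_(q.+1) =>
    s (\row_(j < n.+1) (if (n - q <= j)%N then t ord0 (inord (j - (n - q))) else 0))).

Arguments front : clear implicits.
Arguments back : clear implicits.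

Definition vertex (c : RR) : 'rV[RR]_1 -> RR := restr (fun _ => c).

(* A (completed-)tensor I^* : an element of total degree 1 is a family  *)
(* X_p : {p-simplices} -> A^{1-p}, p >= 0, vanishing on degenerate     *)
(* simplices (normalized cochains).  Its values on functions that are   *)
(* not singular simplices are irrelevant junk.                          *)
(* Differential: d(a (x) alpha) = da (x) alpha + (-1)^|a| a (x) delta alpha,*)
(* (delta alpha)(s) = sum_i (-1)^i alpha(d_i s);                        *)
(* product: (a(x)alpha)(b(x)beta) = (-1)^{|alpha||b|} ab (x) (alpha u beta),  *)
(* (alpha u beta)(s) = alpha(front s) beta(back s)  (Alexander-Whitney).*)
Section Cochains.
Variables (k : comPzRingType) (A : dga k).

Definition cochain1 := forall p : nat, ('rV[RR]_(p.+1) -> RR) -> A (1 - p%:Z).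

Definition normalized (X : cochain1) : Prop :=
  forall m (s : 'rV[RR]_(m.+2) -> RR), is_sing s -> degenerate s -> X m.+1 s = 0.

Definition cochain_sq (X : cochain1) (n : nat) (s : 'rV[RR]_(n.+1) -> RR) : A (2 - n%:Z) :=
  \sum_(p < n.+1)
    (-1) ^+ (p * (n - p).+1) *:
      castd (dgmul A (X p (front n p s)) (X (n - p)%N (back n (n - p) s))).

Definition cochain_cobd (X : cochain1) (m : nat) (s : 'rV[RR]_(m.+2) -> RR)
  : A (2 - (m.+1)%:Z) :=
  (-1) ^+ m.+1 *: \sum_(i < m.+2) (-1) ^+ i *: castd (X m (face i s)).

Definition is_MC_cochain (X : cochain1) : Prop :=
  (forall s : 'rV[RR]_1 -> RR, is_sing s ->
      castd (dgd A (X 0%N s)) + cochain_sq X s = 0 :> A (2 - 0%:Z)) /\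
  (forall m (s : 'rV[RR]_(m.+2) -> RR), is_sing s ->
      castd (dgd A (X m.+1 s)) + cochain_cobd X s + cochain_sq X s = 0
        :> A (2 - (m.+1)%:Z)).

Definition strongly_homotopic (x0 x1 : A 1) : Prop :=
  exists X : cochain1,
    [/\ normalized X, is_MC_cochain X,
        castd (X 0%N (vertex 0)) = x0 & castd (X 0%N (vertex 1)) = x1].

End Cochains.

(* Main.v *)
Require Import Defs.
From HB Require Import structures.
From mathcomp Require Import all_boot all_order all_algebra.
From mathcomp Require Import all_classical all_reals all_analysis.
From mathcomp Require Import Rstruct Rstruct_topology.
From mathcomp Require Import zify.
Set Implicit Arguments. Unset Strict Implicit. Unset Printing Implicit Defensive.
Import Order.TTheory GRing.Theory Num.Theory.
Import numFieldNormedType.Exports.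
Local Open Scope classical_set_scope.
Local Open Scope ring_scope.

(** Both notions are compared with a third one: elements [F_01], [F_10] of
    degree 0 and [h_0], [h_1] of degree -1 such that, with [D_a = d + x_a],
    [D_a F_ab = F_ab D_b] and [D_a h_a + h_a D_a = 1 - F_ab F_ba].

    A Maurer-Cartan cochain [X] yields them by evaluation on the affine
    simplices with vertices 01, 10, 010 and 101: [F = 1 + X] and [h = X].

    Conversely, label a point of [0,1] by 1 if it equals 1 and by 0 otherwise;
    no continuity is needed, so the label words of vertices give a simplicial
    map from the singular set to the nerve of the contractible groupoid on
    {0, 1}.  It remains to choose [U_w] in degree [1 - n] for every alternating
    word [w] of length [n + 1], with [U_a = D_a], so that
    [sum_p +-U_(w_0..w_p) U_(w_p..w_n)] is [1] for [n = 2] and [0] otherwise.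
    After modifying [h_1] there are a null homotopy [r] of [F_01 h_1 - h_0 F_01]
    and hence 2x2 matrices [D], built from [D_0], [F_01], [- D_1], and [H],
    built from [h_0], [r], [F_10], [- h_1], with [D^2 = 0] and [D H + H D = 1].
    The entries of [M_0 = D] and [M_n = c_n H^(2n-1)], where the [c_n] are the
    Catalan numbers with alternating signs, are, up to sign, such [U_w], because
    [sum_i M_i M_(n-i)] is [1] for [n = 1] and [0] otherwise. *)

(** * The graded algebra inside a ring of endomorphisms *)

Section Castd.
Variables (k : pzRingType) (F : int -> lmodType k).

Lemma castd_id i (a : F i) : castd a = a :> F i.
Proof.
rewrite /castd; case: eqP => // e.
by rewrite (Prop_irrelevance e (erefl i)).
Qed.

Lemma castd_neq i j (a : F i) : i <> j -> castd a = 0 :> F j.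
Proof. by rewrite /castd; case: eqP. Qed.

Lemma castd_castd i j l (a : F i) : i = j -> castd (castd a : F j) = castd a :> F l.
Proof. by move=> e; subst j; rewrite castd_id. Qed.

Lemma castdD i j (a b : F i) : castd (a + b) = castd a + castd b :> F j.
Proof.
case: (@eqP _ i j) => [e|e]; first by subst j; rewrite !castd_id.
by rewrite !castd_neq // addr0.
Qed.

Lemma castdZ i j (r : k) (a : F i) : castd (r *: a) = r *: castd a :> F j.
Proof.
case: (@eqP _ i j) => [e|e]; first by subst j; rewrite !castd_id.
by rewrite !castd_neq // scaler0.
Qed.

Lemma castd0 i j : castd (0 : F i) = 0 :> F j.
Proof. by rewrite -(scale0r (0 : F i)) castdZ scale0r. Qed.

(** The degree shift [g] lets one lemma move casts out of the differential and out of multiplication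
    by a fixed element. *)
Lemma castd_app g (phi : forall n, F n -> F (g n)) i j (a : F i) :
  i = j -> phi j (castd a) = castd (phi i a).
Proof. by move=> e; subst j; rewrite !castd_id. Qed.

Lemma castd_fam (v : forall n, F n) i j : i = j -> v j = castd (v i).
Proof. by move=> e; subst j; rewrite castd_id. Qed.

End Castd.

Section Operators.
Variables (k : comPzRingType) (A : dga k).

Lemma dgmulDl i j (a b : A i) (c : A j) :
  dgmul A (a + b) c = dgmul A a c + dgmul A b c.
Proof. by have := dgmul_linl 1 a b c; rewrite !scale1r. Qed.

Lemma dgmulDr i j (a : A i) (b c : A j) :
  dgmul A a (b + c) = dgmul A a b + dgmul A a c.
Proof. by have := dgmul_linr 1 a b c; rewrite !scale1r. Qed.

Lemma dgmul0l i j (c : A j) : dgmul A (0 : A i) c = 0.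
Proof. by apply: (addrI (dgmul A (0 : A i) c)); rewrite -dgmulDl !addr0. Qed.

Lemma dgmul0r i j (a : A i) : dgmul A a (0 : A j) = 0.
Proof. by apply: (addrI (dgmul A a (0 : A j))); rewrite -dgmulDr !addr0. Qed.

Lemma dgmulZl i j r (a : A i) (b : A j) : dgmul A (r *: a) b = r *: dgmul A a b.
Proof. by have := dgmul_linl r a 0 b; rewrite addr0 dgmul0l addr0. Qed.

Lemma dgdD i (a b : A i) : dgd A (a + b) = dgd A a + dgd A b.
Proof. by have := dgd_lin 1 a b; rewrite !scale1r. Qed.

Lemma dgd0 i : dgd A (0 : A i) = 0.
Proof. by apply: (addrI (dgd A (0 : A i))); rewrite -dgdD !addr0. Qed.

(* Additive endomorphisms of the product of all [A n] form an honest ring, in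
   which left multiplications and the differential live together and products
   of graded elements need no casts. *)
Definition fam := forall n : int, A n.
Definition fadd (v w : fam) : fam := fun n => v n + w n.

Record op := Op { opf :> fam -> fam;
  opfD : forall v w, opf (fadd v w) = fadd (opf v) (opf w) }.

Lemma famP (v w : fam) : (forall n, v n = w n) -> v = w.
Proof. by move=> vw; apply: functional_extensionality_dep. Qed.

Lemma opP (u w : op) : (forall v n, u v n = w v n) -> u = w.
Proof.
case: u w => u Hu [w Hw] /= uw.
have e : u = w by apply/funext => v; apply: famP.
by subst w; congr Op; apply: Prop_irrelevance.
Qed.

Fact op_zeroD (v w : fam) : (fun n => 0) = fadd (fun n => 0) (fun n => 0).
Proof. by apply: famP => n; rewrite /fadd addr0. Qed.
Fact op_oppD (u : op) v w : (fun n => - u (fadd v w) n) =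
  fadd (fun n => - u v n) (fun n => - u w n).
Proof. by apply: famP => n; rewrite opfD /fadd opprD. Qed.
Fact op_addD (u u' : op) v w : (fun n => u (fadd v w) n + u' (fadd v w) n) =
  fadd (fun n => u v n + u' v n) (fun n => u w n + u' w n).
Proof. by apply: famP => n; rewrite !opfD /fadd addrACA. Qed.
Fact op_mulD (u u' : op) v w : u (u' (fadd v w)) = fadd (u (u' v)) (u (u' w)).
Proof. by rewrite !opfD. Qed.

Definition op_zero := Op op_zeroD.
Definition op_opp u := Op (op_oppD u).
Definition op_add u u' := Op (op_addD u u').
Definition op_one := @Op id (fun _ _ => erefl).
Definition op_mul u u' := Op (op_mulD u u').

HB.instance Definition _ := gen_eqMixin op.
HB.instance Definition _ := gen_choiceMixin op.

Fact op_addA : associative op_add.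
Proof. by move=> u v w; apply: opP => x n /=; rewrite addrA. Qed.
Fact op_addC : commutative op_add.
Proof. by move=> u v; apply: opP => x n /=; rewrite addrC. Qed.
Fact op_add0 : left_id op_zero op_add.
Proof. by move=> u; apply: opP => x n /=; rewrite add0r. Qed.
Fact op_addN : left_inverse op_zero op_opp op_add.
Proof. by move=> u; apply: opP => x n /=; rewrite addNr. Qed.
Fact op_mulA : associative op_mul. Proof. by move=> u v w; apply: opP. Qed.
Fact op_mul1 : left_id op_one op_mul. Proof. by move=> u; apply: opP. Qed.
Fact op_mulr1 : right_id op_one op_mul. Proof. by move=> u; apply: opP. Qed.
Fact op_mulDl : left_distributive op_mul op_add.
Proof. by move=> u v w; apply: opP. Qed.
Fact op_mulDr : right_distributive op_mul op_add.
Proof.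
move=> u v w; apply: opP => x n /=.
by rewrite -[fun n0 => _]/(fadd (v x) (w x)) opfD.
Qed.

HB.instance Definition _ := GRing.isPzRing.Build op
  op_addA op_addC op_add0 op_addN op_mulA op_mul1 op_mulr1 op_mulDl op_mulDr.

Lemma opDE (u w : op) v n : (u + w) v n = u v n + w v n. Proof. by []. Qed.
Lemma opNE (u : op) v n : (- u) v n = - u v n. Proof. by []. Qed.
Lemma op1E v : (1 : op) v = v. Proof. by []. Qed.
Lemma opME (u w : op) v : (u * w) v = u (w v). Proof. by []. Qed.

Fact iota_subproof i (a : A i) (v w : fam) :
  (fun n => castd (dgmul A a (fadd v w (n - i)))) =
  fadd (fun n => castd (dgmul A a (v (n - i)))) (fun n => castd (dgmul A a (w (n - i)))).
Proof. by apply: famP => n; rewrite /fadd dgmulDr castdD. Qed.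

Definition lmulop i (a : A i) : op := Op (iota_subproof a).

Fact dop_subproof (v w : fam) : (fun n : int => castd (dgd A (fadd v w (n - 1))) : A n) =
  fadd (fun n => castd (dgd A (v (n - 1)))) (fun n => castd (dgd A (w (n - 1)))).
Proof. by apply: famP => n; rewrite /fadd dgdD castdD. Qed.

Definition dop : op := Op dop_subproof.

Lemma lmulopD i (a b : A i) : lmulop (a + b) = lmulop a + lmulop b.
Proof. by apply: opP => v n; rewrite opDE /= dgmulDl castdD. Qed.

Lemma lmulop0 i : lmulop (0 : A i) = 0.
Proof. by apply: (addrI (lmulop (0 : A i))); rewrite -lmulopD !addr0. Qed.

Lemma lmulopN i (a : A i) : lmulop (- a) = - lmulop a.
Proof. by apply/eqP; rewrite -addr_eq0 -lmulopD addNr lmulop0. Qed.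

Lemma lmulop_sum i (I : Type) (r : seq I) (P : pred I) (f : I -> A i) :
  lmulop (\sum_(j <- r | P j) f j) = \sum_(j <- r | P j) lmulop (f j).
Proof. exact: (big_morph _ (@lmulopD i) (lmulop0 i)). Qed.

Lemma lmulop_sign i n (a : A i) : lmulop ((-1) ^+ n *: a) = (-1) ^+ n * lmulop a.
Proof.
rewrite -(signr_odd k) -(signr_odd op); case: (odd n).
  by rewrite !expr1 scaleN1r mulN1r lmulopN.
by rewrite !expr0 scale1r mul1r.
Qed.

Lemma lmulop_castd i j (a : A i) : i = j -> lmulop (castd a : A j) = lmulop a.
Proof. by move=> e; subst j; rewrite castd_id. Qed.

Lemma lmulopM i j (a : A i) (b : A j) : lmulop (dgmul A a b) = lmulop a * lmulop b.
Proof.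
apply: opP => v n; rewrite opME /=.
rewrite -dgmulA castd_castd; last by rewrite addrA.
rewrite (castd_app (@dgmul _ A i ^~ a)); last by lia.
rewrite castd_castd; last by lia.
rewrite (castd_fam v (_ : n - (i + j) = n - i - j)); last by lia.
rewrite (castd_app (@dgmul _ A j ^~ b)); last by lia.
rewrite (castd_app (@dgmul _ A i ^~ a)); last by lia.
by rewrite castd_castd //; lia.
Qed.

Lemma lmulop1 : lmulop (dgone A) = 1.
Proof.
apply: opP => v n; rewrite op1E /=.
rewrite -(castd_castd n (dgmul A (dgone A) (v (n - 0))) (add0r _)) dgmul1l.
by rewrite -castd_fam // subr0.
Qed.

Lemma lmulop_d i (a : A i) :
  dop * lmulop a = lmulop (dgd A a) + (-1) ^+ `|i|%N * (lmulop a * dop).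
Proof.
(* [op A] carries no scalars from [k], so the sign is turned into multiplication by a signed unit of
   [A]. *)
have -> u : (-1) ^+ `|i|%N * u = lmulop ((-1) ^+ `|i|%N *: dgone A) * u.
  by rewrite lmulop_sign lmulop1 mulr1.
apply: opP => v n; rewrite opDE !opME /=.
rewrite (castd_app (@dgd _ A)); last by lia.
rewrite castd_castd; last by lia.
rewrite dgd_Leibniz castdD castd_castd; last by lia.
rewrite castdZ castd_castd; last by lia.
congr (_ + _).
  rewrite (castd_fam v (_ : n - 1 - i = n - (i + 1))); last by lia.
  rewrite (castd_app (@dgmul _ A _ ^~ (dgd A a))); last by lia.
  by rewrite castd_castd //; lia.
rewrite dgmulZl castdZ; congr (_ *: _).
rewrite -(castd_castd n (dgmul A (dgone A) _) (add0r _)) dgmul1l.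
rewrite castd_castd; last by lia.
rewrite (castd_app (@dgmul _ A _ ^~ a)); last by lia.
rewrite castd_castd; last by lia.
rewrite (castd_fam v (_ : n - 1 - i = n - 0 - i - 1)); last by lia.
rewrite (castd_app (@dgd _ A)); last by lia.
rewrite (castd_app (@dgmul _ A _ ^~ a)); last by lia.
by rewrite castd_castd //; lia.
Qed.

Lemma dop2 : dop * dop = 0.
Proof.
apply: opP => v n; rewrite opME /=.
rewrite (castd_app (@dgd _ A)); last by lia.
by rewrite castd_castd ?dgdd ?castd0 //; lia.
Qed.

(** The default 0 of [castd] makes this the family concentrated in degree [i]. *)
Definition single i (a : A i) : fam := fun n => castd a.

Lemma single_inj i (a b : A i) : single a = single b -> a = b.
Proof.
by move=> /(congr1 (fun v : fam => v i)); rewrite /single !castd_id.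
Qed.

Lemma single_castd i j (a : A i) : i = j -> single (castd a : A j) = single a.
Proof. by move=> e; subst j; rewrite castd_id. Qed.

Lemma singleD i (a b : A i) : single (a + b) = fadd (single a) (single b).
Proof. by apply: famP => n; rewrite /fadd /single castdD. Qed.

Lemma single0 i : single (0 : A i) = fun n => 0.
Proof. by apply: famP => n; rewrite /single castd0. Qed.

Lemma lmulop_single i j (a : A i) (b : A j) : lmulop a (single b) = single (dgmul A a b).
Proof.
apply: famP => n; rewrite /single /=.
case: (@eqP _ j (n - i)) => [e|e].
  by rewrite (castd_app (@dgmul _ A _ ^~ a)) // castd_castd // e.
by rewrite (castd_neq b e) dgmul0r castd0 castd_neq //; lia.
Qed.

Lemma dop_single i (a : A i) : dop (single a) = single (dgd A a).
Proof.
apply: famP => n; rewrite /single /=.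
case: (@eqP _ i (n - 1)) => [e|e].
  by rewrite (castd_app (@dgd _ A)) // castd_castd // e.
by rewrite (castd_neq a e) dgd0 castd0 castd_neq //; lia.
Qed.

Lemma lmulop_single1 i (a : A i) : lmulop a (single (dgone A)) = single a.
Proof. by rewrite lmulop_single -(@single_castd _ i) ?addr0 // dgmul1r. Qed.

(** Evaluation at the unit recovers the element, so identities in [A] can be checked in the ring
    [op A]. *)
Lemma lmulop_inj i (a b : A i) : lmulop a = lmulop b -> a = b.
Proof.
move=> ab; apply: single_inj.
by rewrite -lmulop_single1 ab lmulop_single1.
Qed.

Definition homog i (u : op) := exists a : A i, u = lmulop a.

Lemma homogD i u w : homog i u -> homog i w -> homog i (u + w).
Proof. by move=> [a ->] [b ->]; exists (a + b); rewrite lmulopD. Qed.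

Lemma homogN i u : homog i u -> homog i (- u).
Proof. by move=> [a ->]; exists (- a); rewrite lmulopN. Qed.

Lemma homogM i j l u w : homog i u -> homog j w -> i + j = l -> homog l (u * w).
Proof.
by move=> [a ->] [b ->] <-; exists (dgmul A a b); rewrite lmulopM.
Qed.

Lemma homog1 : homog 0 1.
Proof. by exists (dgone A); rewrite lmulop1. Qed.

Lemma homog0 i : homog i (0 : op).
Proof. by exists 0; rewrite lmulop0. Qed.

Lemma homogMz i (u : op) (c : int) : homog i u -> homog i (u *~ c).
Proof.
move=> hu; have hn n : homog i (u *+ n).
  elim: n => [|n IH]; first by rewrite mulr0n; exact: homog0.
  by rewrite mulrS; apply: homogD.
by case: c => n /=; [exact: hn|apply: homogN; exact: hn].
Qed.

Lemma homog_lmulop i j (a : A i) : i = j -> homog j (lmulop a).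
Proof. by move=> <-; exists a. Qed.

Lemma homog_eq0 i u : homog i u -> u (single (dgone A)) = (fun n => 0) -> u = 0.
Proof.
move=> [a ->]; rewrite lmulop_single1 -(single0 i) => /single_inj ->.
exact: lmulop0.
Qed.

End Operators.

(** * The coherent tower *)

(** The generating series satisfies [E(u) + u E(u)^2 = 1]. Each term needs all earlier ones, so the
    recursion runs on lists of initial values. *)
Lemma signed_catalan : exists e : nat -> int,
  e 0%N = 1 /\ forall m, e m.+1 = - \sum_(i < m.+1) e i * e (m - i)%N.
Proof.
pose step m (s : seq int) := rcons s (- \sum_(i < m.+1) s`_i * s`_(m - i)%N).
pose L := fix L m := if m is m'.+1 then step m' (L m') else [:: 1 : int].
have sL m : size (L m) = m.+1 by elim: m => //= m IH; rewrite size_rcons IH.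
have nthL m i : (i <= m)%N -> (L m)`_i = (L i)`_i.
  elim: m => [|m IH]; first by case: i.
  rewrite leq_eqVlt => /orP[/eqP -> //|im].
  by rewrite /= nth_rcons sL im IH.
exists (fun m => (L m)`_m); split=> // m.
rewrite /= nth_rcons sL ltnn eqxx; congr (- _); apply: eq_bigr => i _.
by rewrite !nthL // ?leq_subr // -ltnS.
Qed.

(** Put [M(t) = D + t H E(t H^2)] with [E] the series of the signed Catalan numbers; the sums say
    [M(t)^2 = t]. As [D] commutes with [H^2], the cross terms add up to [t E(u)] with [u = t H^2],
    and [E(u) + u E(u)^2 = 1]. *)
Lemma square_zero_tower (S : pzRingType) (D H : S) :
  D * D = 0 -> D * H + H * D = 1 ->
  exists M : nat -> S,
    [/\ M 0%N = D,
        forall n, exists c : int, M n.+1 = H ^+ n.*2.+1 *~ c &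
        forall n, \sum_(i < n.+1) M i * M (n - i)%N = (n == 1%N)%:R].
Proof.
move=> DD DH; have [e [e0 eS]] := signed_catalan.
have DH2 m : D * H ^+ m.*2 = H ^+ m.*2 * D.
  elim: m => [|m IH]; first by rewrite expr0 mulr1 mul1r.
  have C2 : D * H ^+ 2 = H ^+ 2 * D.
    have -> : D * H ^+ 2 = (1 - H * D) * H by rewrite -DH addrK expr2 mulrA.
    have -> : H ^+ 2 * D = H * (1 - D * H) by rewrite -DH [_ + H * D]addrC addrK expr2 mulrA.
    by rewrite mulrBl mulrBr mul1r mulr1 !mulrA.
  by rewrite doubleS -add2n exprD mulrA C2 -mulrA IH mulrA.
exists (fun n => if n is n'.+1 then H ^+ n'.*2.+1 *~ e n' else D).
split=> //; first by move=> n; exists (e n).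
case=> [|[|m]]; first by rewrite big_ord1 DD.
  by rewrite big_ord_recl big_ord1 /= e0 mulr1z expr1 DH.
(* The two outer terms contain [D] and give [e m.+1] times a power of [H]; the Catalan recursion
   cancels this against the inner terms. *)
rewrite big_ord_recl big_ord_recr /= ?subn0.
rewrite (_ : (m.+2 - bump 0 m.+1 = 0)%N); last by rewrite /bump /=; lia.
rewrite [LHS]addrCA !add0n.
have -> : D * (H ^+ (m.+1).*2.+1 *~ e m.+1) + H ^+ (m.+1).*2.+1 *~ e m.+1 * D
    = H ^+ (m.+1).*2 *~ e m.+1.
  rewrite mulrzAr mulrzAl -mulrzDl; congr (_ *~ _).
  move: (DH2 m.+1); move: (m.+1).*2 => K DK.
  by rewrite exprSr mulrA DK -!mulrA -mulrDr DH mulr1.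
rewrite (eq_bigr (fun i : 'I_m.+1 => H ^+ (m.+1).*2 *~ (e i * e (m - i)%N))); last first.
  move=> i _; have im := ltn_ord i.
  rewrite (_ : (m.+2 - bump 0 i = (m - i).+1)%N); last by rewrite /bump /=; lia.
  rewrite mulrzAl mulrzAr -exprD -mulrzA [e i * _]mulrC.
  by congr (_ ^+ _ *~ _); lia.
by rewrite -mulrz_sumr -mulrzDr eS subrr mulr0z.
Qed.

(** * Two by two matrices unrolled along alternating words *)

Lemma big_ord_double (S : nmodType) (F : nat -> S) m :
  \sum_(i < m.*2) F i = \sum_(j < m) (F j.*2 + F j.*2.+1).
Proof.
by elim: m => [|m IH]; rewrite ?big_ord0 // doubleS !big_ord_recr /= IH addrA.
Qed.

Definition bord (b : bool) : 'I_2 := if b then ord_max else ord0.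

Lemma mulmx2E (R : pzRingType) (X Y : 'M[R]_2) a c :
  (X * Y) a c = X a (bord false) * Y (bord false) c + X a (bord true) * Y (bord true) c.
Proof.
rewrite mxE big_ord_recl big_ord1; congr (_ + _ * _); congr (_ _ _);
  exact/val_inj.
Qed.

Lemma mx2P (R : pzRingType) (X Y : 'M[R]_2) :
  (forall a b, X (bord a) (bord b) = Y (bord a) (bord b)) -> X = Y.
Proof.
move=> XY; apply/matrixP => i j.
have bordK (l : 'I_2) : l = bord (l == ord_max).
  by apply/val_inj; case: l => [[|[|l]] Hl].
by rewrite (bordK i) (bordK j).
Qed.

Definition mx2 (R : pzRingType) (f : bool -> bool -> R) : 'M[R]_2 :=
  \matrix_(i, j) f (i == ord_max) (j == ord_max).

Lemma mx2E (R : pzRingType) (f : bool -> bool -> R) a b :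
  mx2 f (bord a) (bord b) = f a b.
Proof. by rewrite mxE; case: a; case: b. Qed.

Section MatrixTower.
Variables (R : pzRingType) (M : nat -> 'M[R]_2).

(* [unroll a n] belongs to the alternating word of length [n + 1] starting with
   [a]: [M m] holds the words from 0 with [n = 2 m, 2 m + 1] in its first row and
   those from 1 with [n = 2 m - 1, 2 m] in its second row. *)
Definition unroll (a : bool) (n : nat) : R :=
  M (n + a)./2 (bord a) (bord (odd (n + a))).

(* These signs absorb the Koszul signs [(-1) ^+ (p * (n - p).+1)] of the
   cochain product. *)
Definition signed_unroll (a : bool) (n : nat) : R :=
  if a && ~~ odd n then - unroll a n else unroll a n.

Hypothesis M010 : M 0%N (bord true) (bord false) = 0.
Hypothesis MM : forall n, \sum_(i < n.+1) M i * M (n - i)%N = (n == 1%N)%:R.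

(** The summands at positions [i + a = 2 j] and [2 j + 1] form one entry of [M j * M (m - j)], so
    [MM] evaluates the sum. Positions [0] and [2 m + 1], when missing, may be added because the
    lower left entry of [M 0] is 0. *)
Lemma sum_unroll a n :
  \sum_(i < n.+1) unroll a i * unroll (a (+) odd i) (n - i)%N = (n == 2%N)%:R.
Proof.
set m := (n + a)./2; set c := odd (n + a).
pose G i := M i./2 (bord a) (bord (odd i)) * M (m - i./2)%N (bord (odd i)) (bord c).
have GE (i : 'I_n.+1) : unroll a i * unroll (a (+) odd i) (n - i)%N = G (i + a)%N.
  have ni : (i <= n)%N by rewrite -ltnS.
  rewrite /unroll /G /m /c; congr (_ * _).
  have -> : a (+) odd i = odd (i + a) by rewrite oddD oddb addbC.
  have E : (n - i + odd (i + a) = (n + a) - (i + a)./2.*2)%N by lia.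
  have le : ((i + a)./2.*2 <= n + a)%N by lia.
  rewrite E oddB // odd_double addbF; congr (M _ _ _); lia.
rewrite (eq_bigr _ (fun i _ => GE i)) {GE}.
have -> : \sum_(i < n.+1) G (i + a)%N = \sum_(i < (m.+1).*2) G i.
  have G0 : a -> G 0%N = 0 by rewrite /G => ->; rewrite M010 mul0r.
  have Gl : ~~ c -> G m.*2.+1 = 0.
    move=> /negbTE c0; rewrite /G c0 (_ : (m - _ = 0)%N); last by lia.
    by rewrite (_ : odd m.*2.+1 = true) ?M010 ?mulr0 //=; lia.
  have {G0} -> : \sum_(i < n.+1) G (i + a)%N = \sum_(i < (n + a).+1) G i.
    case: a @c @m @G G0 Gl => c m G G0 Gl; last first.
      by rewrite addn0; apply: eq_bigr => i _; rewrite addn0.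
    rewrite addn1 [RHS]big_ord_recl G0 // add0r.
    by apply: eq_bigr => i _; rewrite addn1.
  have E : (n + a = m.*2 + c)%N by rewrite /m /c; lia.
  rewrite E doubleS; case: (c) Gl => /= Gl; first by rewrite addn1.
  by rewrite addn0 [RHS]big_ord_recr /= Gl // addr0.
rewrite big_ord_double.
have -> : \sum_(j < m.+1) (G j.*2 + G j.*2.+1) =
          (\sum_(j < m.+1) M j * M (m - j)%N) (bord a) (bord c).
  rewrite summxE; apply: eq_bigr => j _.
  by rewrite mulmx2E /G /= odd_double doubleK uphalf_double.
rewrite MM.
(* [m = 1] leaves two values of [n]; the diagonal of the identity matrix picks out [n = 2]. *)
have -> : (n == 2) = (m == 1%N) && (a == c).
  rewrite /m /c; case: (a); case: (boolP (odd _)); lia.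
case: (m == 1%N); last by rewrite mxE.
by rewrite mxE; case: (a); case: (c).
Qed.

(** Each summand is [(-1) ^+ (a && odd n)] times the unsigned one, a sign independent of [i] and
    equal to 1 when [n = 2]. *)
Lemma sum_signed_unroll a n :
  \sum_(i < n.+1) (-1) ^+ (i * (n - i).+1) *
    (signed_unroll a i * signed_unroll (a (+) odd i) (n - i)%N) = (n == 2%N)%:R.
Proof.
have -> : (n == 2)%:R = (-1) ^+ (a && odd n) * (n == 2)%:R :> R.
  by case: (eqVneq n 2) => [->|]; rewrite ?andbF ?expr0 ?mul1r ?mulr0.
rewrite -(sum_unroll a) mulr_sumr; apply: eq_bigr => i _.
have ni : (i <= n)%N by rewrite -ltnS.
rewrite -signr_odd oddM /= oddB // /signed_unroll oddB //.
by case: a; case: (odd i); case: (odd n);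
  rewrite /= ?expr0 ?expr1 ?mulN1r ?mul1r ?mulrN ?mulNr ?opprK.
Qed.

End MatrixTower.

Section Tower.
Variables (k : comPzRingType) (A : dga k).

(** Degrees of endomorphisms of a sum of two copies of [A], one shifted by one, as in a mapping
    cone. *)
Definition mxhomog (d : int) (M : 'M[op A]_2) :=
  forall a b : bool, homog (d + a%:Z - b%:Z) (M (bord a) (bord b)).

Lemma mxhomogM d e M N : mxhomog d M -> mxhomog e N -> mxhomog (d + e) (M * N).
Proof.
move=> hM hN a b; rewrite mulmx2E.
by apply: homogD; apply: (homogM (hM a _) (hN _ b)); lia.
Qed.

Lemma mxhomogX M n : mxhomog (-1) M -> mxhomog (- (n.+1)%:Z) (M ^+ n.+1).
Proof.
move=> hM; elim: n => [|n IH]; first by rewrite expr1.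
by rewrite exprS (_ : - _ = -1 + - (n.+1)%:Z); [exact: mxhomogM|lia].
Qed.

Lemma mxhomogMz d M (c : int) : mxhomog d M -> mxhomog d (M *~ c).
Proof.
move=> hM a b.
have -> : (M *~ c) (bord a) (bord b) = M (bord a) (bord b) *~ c.
  have hn n : (M *+ n) (bord a) (bord b) = M (bord a) (bord b) *+ n.
    by elim: n => [|n IH]; rewrite ?mulr0n ?mulrS mxE // IH.
  by case: c => n /=; rewrite ?mxE hn.
exact: homogMz.
Qed.

(** [Dm] is the differential of the mapping cone of [p], and [H] contracts it because [p] is a
    homotopy equivalence. Unrolling the resulting tower gives [U]. *)
Lemma coherent_tower (D : bool -> op A) (p q h h' : op A) :
  homog 0 p -> homog 0 q -> homog (-1) h -> homog (-1) h' ->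
  (forall a, D a * D a = 0) ->
  D false * p = p * D true -> D true * q = q * D false ->
  D false * h + h * D false = 1 - p * q ->
  D true * h' + h' * D true = 1 - q * p ->
  exists U : bool -> nat -> op A,
    [/\ forall a, U a 0%N = D a,
        forall a n, homog (- n%:Z) (U a n.+1) &
        forall a n, \sum_(i < n.+1) (-1) ^+ (i * (n - i).+1) *
          (U a i * U (a (+) odd i) (n - i)%N) = (n == 2%N)%:R].
Proof.
move=> Hp Hq Hh Hh' DD Dp Dq Dh Dh'.
(* [e] measures how far [h] and [h'] are from commuting with [p]. Subtracting [q * e] from [h']
   turns it into [(1 - p q) e], which is the boundary of [h * e] since [e] is a cycle. *)
pose e := p * h' - h * p; pose h1 := h' - q * e; pose r := h * e.
have He : homog (-1) e.
  by apply: homogD; [apply: homogM Hp Hh' _|apply/homogN; apply: homogM Hh Hp _].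
have De : D false * e + e * D true = 0.
  rewrite /e mulrBr mulrBl addrACA -opprD.
  have -> : D false * (p * h') + p * h' * D true = p - p * q * p.
    by rewrite mulrA Dp -!mulrA -mulrDr Dh' mulrBr mulr1 mulrA.
  have -> : D false * (h * p) + h * p * D true = p - p * q * p.
    by rewrite -[h * p * _]mulrA -Dp !mulrA -mulrDl Dh mulrBl mul1r.
  exact: subrr.
have Dr : D false * r - r * D true = p * h1 - h * p.
  have -> : r * D true = - (h * D false * e).
    by rewrite /r -!mulrA -mulrN; congr (h * _); apply/eqP; rewrite -addr_eq0 addrC De.
  rewrite opprK /r mulrA -mulrDl Dh mulrBl mul1r /h1 [p * (_ - _)]mulrBr [RHS]addrAC.
  by rewrite -/e mulrA.
have Dh1 : D true * h1 + h1 * D true = 1 - q * p.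
  rewrite /h1 mulrBr mulrBl addrACA -opprD Dh' mulrA Dq -!mulrA -mulrDr De.
  by rewrite mulr0 subr0.
pose Dm := mx2 (fun a b => if a then if b then - D true else 0
                           else if b then p else D false).
pose H := mx2 (fun a b => if a then if b then - h1 else q
                          else if b then r else h).
have DmDm : Dm * Dm = 0.
  apply: mx2P => a b; rewrite mulmx2E !mx2E mxE.
  case: a; case: b; rewrite ?mul0r ?mulr0 ?mulNr ?mulrN ?DD ?Dp ?oppr0 ?addr0 //.
  exact: subrr.
(* The four entries reduce to [Dh1], [Dq], [Dr] and [Dh]. *)
have DmH : Dm * H + H * Dm = 1.
  apply: mx2P => a b; rewrite mxE !mulmx2E !mx2E mxE.
  case: a; case: b; rewrite ?mul0r ?mulr0 ?mulNr ?mulrN ?opprK ?addr0 ?add0r /=.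
  - by rewrite [q * p + _]addrC addrA Dh1 subrK.
  - by rewrite Dq addNr.
  - by rewrite [h * p + _]addrC addrACA Dr addrACA subrr addNr addr0.
  - by rewrite addrAC Dh subrK.
have [M [M0 MX MM]] := square_zero_tower DmDm DmH.
have M010 : M 0%N (bord true) (bord false) = 0 by rewrite M0 mx2E.
exists (signed_unroll M); split.
- move=> a; have -> : signed_unroll M a 0%N = (if a then - M 0%N (bord a) (bord a)
                                            else M 0%N (bord a) (bord a)).
    by rewrite /signed_unroll /unroll add0n oddb; case: a.
  by rewrite M0 mx2E; case: a; rewrite ?opprK.
- move=> a n.
  suff : homog (- n%:Z) (unroll M a n.+1).
    by rewrite /signed_unroll; case: ifP => // _; apply: homogN.
  rewrite /unroll; case E: ((n.+1 + a)./2) => [|m].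
    (* At a positive index, [p] is the only entry of [M 0] that is reached. *)
    have [-> ->] : n = 0%N /\ a = false by case: (a) E; lia.
    by rewrite M0 mx2E.
  have [c ->] := MX m.
  have HH : mxhomog (-1) H.
    have Hr : homog (-2) r by apply: homogM Hh He _.
    have Hh1 : homog (-1) h1.
      by apply: homogD => //; apply/homogN; apply: homogM Hq He _.
    by case; case; rewrite /H mx2E //; apply: homogN.
  have := mxhomogMz c (mxhomogX m.*2 HH) a (odd (n.+1 + a)).
  by congr (homog _ _); lia.
- exact: sum_signed_unroll.
Qed.

End Tower.

(** * Singular simplices of the interval *)

(* The affine map of simplices sending the vertex [j] to the vertex [phi j]. *)
Definition push m n (phi : nat -> nat) (t : 'rV[RR]_(m.+1)) : 'rV[RR]_(n.+1) :=
  \row_l \sum_(j < m.+1 | phi j == l) t ord0 j.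
Arguments push : clear implicits.

(** Cofaces, codegeneracies and the front and back inclusions are all cast as [push], so that
    naturality is proved once for all of them. *)
Lemma coface_push m (i : 'I_m.+2) t : coface i t = push m m.+1 (bump i) t.
Proof.
apply/rowP => l; rewrite !mxE; have li := ltn_ord l.
case: ltnP => [il|li'].
  rewrite (big_pred1 (inord l)) // => j /=.
  by rewrite -val_eqE /= inordK; [rewrite /bump; lia|have := ltn_ord i; lia].
case: eqP => [e|ne].
  by rewrite big_pred0 // => j; rewrite /bump; lia.
rewrite (big_pred1 (inord l.-1)) // => j /=.
by rewrite -val_eqE /= inordK; [rewrite /bump; lia|lia].
Qed.

Lemma face_push m (i : 'I_m.+2) s : face i s = restr (s \o push m m.+1 (bump i)).
Proof. by rewrite /face; congr restr; apply/funext => t /=; rewrite coface_push. Qed.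

Lemma front_push n p s : (p <= n)%N -> front n p s = restr (s \o push p n id).
Proof.
move=> pn; rewrite /front; congr restr; apply/funext => t /=; congr s.
apply/rowP => l; rewrite !mxE; case: leqP => lp.
  rewrite (big_pred1 (inord l)) // => j /=.
  by rewrite -val_eqE /= inordK.
by rewrite big_pred0 // => j /=; have := ltn_ord j; lia.
Qed.

Lemma back_push n q s : (q <= n)%N ->
  back n q s = restr (s \o push q n (addn (n - q))).
Proof.
move=> qn; rewrite /back; congr restr; apply/funext => t /=; congr s.
apply/rowP => l; rewrite !mxE; have ln := ltn_ord l; case: leqP => lq.
  rewrite (big_pred1 (inord (l - (n - q)))) // => j /=.
  by rewrite -val_eqE /= inordK; lia.
by rewrite big_pred0 // => j /=; lia.
Qed.

Lemma codeg_push m (j : 'I_m.+1) t : codeg j t = push m.+1 m (unbump j) t.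
Proof.
apply/rowP => l; rewrite !mxE; have lm := ltn_ord l.
case: ltnP => [lj|jl].
  rewrite (big_pred1 (inord l)) // => i /=.
  by rewrite -val_eqE /= inordK; [rewrite /unbump; lia|lia].
case: eqP => [e|ne].
  rewrite (bigD1 (inord l)) /=; last by rewrite inordK; [rewrite /unbump; lia|lia].
  congr (_ + _); rewrite (big_pred1 (inord l.+1)) // => i /=.
  by rewrite -!val_eqE /= !inordK; [rewrite /unbump; lia|lia|lia].
rewrite (big_pred1 (inord l.+1)) // => i /=.
by rewrite -val_eqE /= inordK; [rewrite /unbump; lia|lia].
Qed.

(** Weights 1 show that [push] preserves the standard simplex; the weights of a word compute
    [affine] along [push]. *)
Lemma push_sum m n phi (c : nat -> RR) t :
  (forall j, (j <= m)%N -> (phi j <= n)%N) ->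
  \sum_(l < n.+1) c l * push m n phi t ord0 l = \sum_(j < m.+1) c (phi j) * t ord0 j.
Proof.
move=> phin; under eq_bigr => l _ do rewrite mxE mulr_sumr.
under eq_bigr => l _ do rewrite big_mkcond.
rewrite exchange_big /=; apply: eq_bigr => j _.
have pj : (phi j < n.+1)%N by rewrite ltnS phin // -ltnS.
by rewrite -big_mkcond (big_pred1 (Ordinal pj)).
Qed.

Lemma push_simplex m n phi t : (forall j, (j <= m)%N -> (phi j <= n)%N) ->
  stdsimplex m t -> stdsimplex n (push m n phi t).
Proof.
move=> phin [t0 t1]; split; first by move=> l; rewrite mxE sumr_ge0.
have := push_sum (fun=> 1) t phin.
by under eq_bigr => l _ do rewrite mul1r; move=> ->; under eq_bigr do rewrite mul1r.
Qed.

Lemma restrE n (f : 'rV[RR]_n.+1 -> RR) t : stdsimplex n t -> restr f t = f t.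
Proof. by move=> st; rewrite /restr asboolT. Qed.

Lemma restr_push m n phi f : (forall j, (j <= m)%N -> (phi j <= n)%N) ->
  restr (restr f \o push m n phi) = restr (f \o push m n phi).
Proof.
move=> phin; apply/funext => t; rewrite /restr /=.
case: asboolP => // st; rewrite asboolT //; exact: push_simplex.
Qed.

Definition stdvertex n (j : nat) : 'rV[RR]_(n.+1) := \row_l (l == j :> nat)%:R.
Arguments stdvertex : clear implicits.

Lemma stdvertex_simplex n j : (j <= n)%N -> stdsimplex n (stdvertex n j).
Proof.
move=> jn; split; first by move=> l; rewrite mxE ler0n.
rewrite (bigD1 (inord j)) //= mxE inordK // eqxx big1 ?addr0 // => l.
by rewrite -val_eqE /= inordK // mxE => /negbTE ->.
Qed.

Lemma push_stdvertex m n phi j : (j <= m)%N ->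
  push m n phi (stdvertex m j) = stdvertex n (phi j).
Proof.
move=> jm; apply/rowP => l; rewrite !mxE.
under eq_bigr => i _ do rewrite mxE.
rewrite big_mkcond (bigD1 (inord j)) //= inordK // eqxx big1 ?addr0; last first.
  by move=> i; rewrite -val_eqE /= inordK // => /negbTE ->; case: ifP.
by rewrite eq_sym; case: eqP.
Qed.

Definition affine n (w : nat -> bool) : 'rV[RR]_(n.+1) -> RR :=
  restr (fun t => \sum_(j < n.+1) (w j)%:R * t ord0 j).
Arguments affine : clear implicits.

Lemma affine_push m n phi w : (forall j, (j <= m)%N -> (phi j <= n)%N) ->
  restr (affine n w \o push m n phi) = affine m (w \o phi).
Proof.
move=> phin; rewrite /affine restr_push //; congr restr; apply/funext => t /=.
exact: (push_sum (fun j => (w j)%:R)).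
Qed.

Lemma affine_sing n w : is_sing (affine n w).
Proof.
split.
- have C : {within stdsimplex n, continuous
      (fun t : 'rV[RR]_(n.+1) => \sum_(j < n.+1) (w j)%:R * t ord0 j)}.
    apply: continuous_subspaceT.
    elim: (index_enum _) => [|j r IH].
      by under eq_fun do rewrite big_nil; exact: cst_continuous.
    under eq_fun do rewrite big_cons.
    move=> t; apply: (@continuousD _ RR^o _ (fun x : 'rV[RR]_n.+1 => (w j)%:R * x ord0 j) _ t _ (IH t)).
    apply: (@continuousM RR^o _ (fun=> (w j)%:R) (fun x : 'rV[RR]_n.+1 => x ord0 j) t (@cst_continuous _ _ _ _)).
    exact: coord_continuous.
  move: C; apply: subspace_eq_continuous => t.
  by rewrite inE => st; rewrite [RHS]restrE.
- move=> t st; rewrite /affine restrE //; case: st => t0 t1.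
  rewrite sumr_ge0 /=; last by move=> j _; rewrite mulr_ge0.
  rewrite -[leRHS]t1; apply: ler_sum => j _.
  by case: (w j); rewrite ?mul1r ?mul0r.
- by move=> t st; rewrite /affine /restr asboolF.
Qed.

Lemma affine_degenerate m (w : nat -> bool) (j : 'I_m.+1) : w j = w j.+1 ->
  degenerate (affine m.+1 w).
(* Deleting the letter [j] and pulling back along the codegeneracy [j] restores the word, as the
   letters [j] and [j + 1] agree. *)
Proof.
move=> wj; exists j, (affine m (w \o bump j)); split; first exact: affine_sing.
have -> : codeg j = push m.+1 m (unbump j) by apply/funext => t; rewrite codeg_push.
rewrite affine_push; last by move=> i; rewrite /unbump; have := ltn_ord j; lia.
congr restr; apply/funext => t; apply: eq_bigr => i _; congr ((_ : bool)%:R * _) => /=.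
case: (eqVneq (i : nat) j) => [->|ij].
  by rewrite wj /unbump /bump ltnn subn0 leqnn.
by congr w; rewrite unbumpKcond (negbTE ij).
Qed.

Lemma affine_vertex w : affine 0 w = vertex (w 0%N)%:R.
Proof.
apply/funext => t; rewrite /affine /vertex /restr; case: asboolP => // -[_].
by rewrite !big_ord1 => ->; rewrite mulr1.
Qed.

(** * Cochains and words *)

Section CochainOperators.
Variables (k : comPzRingType) (A : dga k).

Lemma lmulop_sq (X : cochain1 A) n s : lmulop (cochain_sq X (n := n) s) =
  \sum_(p < n.+1) (-1) ^+ (p * (n - p).+1) *
    (lmulop (X p (front n p s)) * lmulop (X (n - p)%N (back n (n - p) s))).
Proof.
rewrite lmulop_sum; apply: eq_bigr => p _; have pn := ltn_ord p.
rewrite lmulop_sign lmulop_castd ?lmulopM //; lia.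
Qed.

Lemma lmulop_cobd (X : cochain1 A) m s : lmulop (cochain_cobd X (m := m) s) =
  (-1) ^+ m.+1 * \sum_(i < m.+2) (-1) ^+ i * lmulop (X m (face i s)).
Proof.
rewrite lmulop_sign lmulop_sum; congr (_ * _); apply: eq_bigr => p _.
rewrite lmulop_sign lmulop_castd //; lia.
Qed.

(** A value on an [n]-simplex has degree [1 - n], of parity opposite to [n]; this fixes the sign of
    the graded commutator with [dop]. *)
Lemma lmulop_dgd n (a : A (1 - n%:Z)) : lmulop (castd (dgd A a) : A (2 - n%:Z)) =
  dop A * lmulop a + (-1) ^+ n * (lmulop a * dop A).
Proof.
rewrite lmulop_castd; last by lia.
have -> : (-1) ^+ n = - (-1) ^+ `|1 - n%:Z|%N :> op A.
  rewrite -signr_odd -[in RHS]signr_odd.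
  have -> : odd n = ~~ odd `|1 - n%:Z|%N by lia.
  by case: (odd _); rewrite ?expr0 ?expr1 ?opprK.
by rewrite lmulop_d mulNr addrK.
Qed.

(** The differential of the twisted module [A^[x]]; its square is multiplication by the curvature of
    [x]. *)
Definition MCop (x : A 1) : op A := dop A + lmulop x.

Lemma is_MC_op (x : A 1) : is_MC x <-> MCop x * MCop x = 0.
Proof.
have -> : MCop x * MCop x = lmulop (dgd A x + dgmul A x x).
  rewrite /MCop lmulopD lmulopM mulrDl !mulrDr dop2 add0r lmulop_d expr1 mulN1r.
  by rewrite addrA subrK.
by split=> [->|]; [exact: lmulop0|rewrite -(lmulop0 A (1 + 1)) => /lmulop_inj].
Qed.

End CochainOperators.

(** * The Maurer-Cartan equation on words *)

Section Words.
Variables (k : comPzRingType) (A : dga k).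
Variable U : bool -> nat -> op A.

Definition word_eq n (w w' : nat -> bool) := forall j, (j <= n)%N -> w j = w' j.

Definition alternates n (w : nat -> bool) := [forall j : 'I_n, w j != w j.+1].

Lemma alternatesP n w : reflect (forall j, (j < n)%N -> w j.+1 = ~~ w j) (alternates n w).
Proof.
apply: (iffP forallP) => [H j jn|H j].
  by have := H (Ordinal jn); case: (w j); case: (w _).
by rewrite H //; case: (w j).
Qed.

Lemma alternatesPn n w : ~~ alternates n w -> exists2 j, (j < n)%N & w j.+1 = w j.
Proof.
by rewrite negb_forall => /existsP[j]; rewrite negbK => /eqP e; exists j.
Qed.

Lemma alternates_odd n w j : alternates n w -> (j <= n)%N -> w j = w 0%N (+) odd j.
Proof.
move=> /alternatesP H; elim: j => [|j IH] jn; first by rewrite addbF.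
by rewrite H // IH 1?ltnW //= addbN.
Qed.

Lemma alternates_eq n w w' : word_eq n w w' -> alternates n w = alternates n w'.
Proof.
by move=> ww; apply: eq_forallb => j; rewrite !ww // ltnW.
Qed.

(* The difference between [U] and the cochain: the differential in degree 0 and,
   in degree 1, the unit completing a 1-simplex to a morphism. *)
Definition unitpart n : op A := if n is m.+1 then (m == 0%N)%:R else dop A.

Definition word_op n w : op A := if alternates n w then U (w 0%N) n - unitpart n else 0.

Lemma word_op_eq n w w' : word_eq n w w' -> word_op n w = word_op n w'.
Proof. by move=> ww; rewrite /word_op (alternates_eq ww) ww. Qed.

Lemma word_op_repeat n w j : (j < n)%N -> w j.+1 = w j -> word_op n w = 0.
Proof.
move=> jn e; rewrite /word_op; case: alternatesP => // H.
by have := H _ jn; rewrite e; case: (w j).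
Qed.

(** The left side of the Maurer-Cartan equation at a simplex whose vertices spell [w]. *)
Definition word_curvature n w : op A :=
  dop A * word_op n w + (-1) ^+ n * (word_op n w * dop A) +
  (if n is m.+1 then
     (-1) ^+ n * \sum_(i < n.+1) (-1) ^+ i * word_op m (w \o bump i) else 0) +
  \sum_(p < n.+1) (-1) ^+ (p * (n - p).+1) *
    (word_op p w * word_op (n - p) (w \o addn p)).

(** Every term inherits the repetition except the two faces that delete one of the equal letters;
    these coincide and carry opposite signs. *)
Lemma word_curvature_repeat n w : ~~ alternates n w -> word_curvature n w = 0.
Proof.
move=> /alternatesPn [j jn e]; rewrite /word_curvature (word_op_repeat jn e).
rewrite mulr0 mul0r mulr0 !add0r.
rewrite [X in _ + X]big1 ?addr0; last first.
  move=> p _; have pn := ltn_ord p; case: (ltnP j p) => [jp|pj].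
    by rewrite (word_op_repeat jp e) mul0r mulr0.
  rewrite (@word_op_repeat (n - p) _ (j - p)) ?mulr0 //; first by lia.
  by rewrite /= addnS subnKC.
case: n jn => // m jm.
pose j0 : 'I_m.+2 := inord j; pose j1 : 'I_m.+2 := inord j.+1.
have j0E : j0 = j :> nat by rewrite inordK //; lia.
have j1E : j1 = j.+1 :> nat by rewrite inordK //; lia.
clearbody j0 j1.
rewrite (bigD1 j0) //= (bigD1 j1) /=; last by rewrite -val_eqE /= j0E j1E; lia.
rewrite big1 ?addr0.
  rewrite j0E j1E [(-1) ^+ j.+1]exprS mulN1r mulNr.
  rewrite (@word_op_eq m (w \o bump j) (w \o bump j.+1)) ?subrr ?mulr0 //.
  move=> l _ /=; case: (eqVneq l j) => [->|lj]; first by rewrite /bump leqnn ltnn.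
  by congr w; rewrite /bump; lia.
move=> i /andP[]; rewrite -!val_eqE /= j0E j1E => ij0 ij1; have im := ltn_ord i.
case: (ltnP i j) => ij.
  apply/eqP; rewrite (@word_op_repeat m _ j.-1) ?mulr0 //=; first by clear -jm ij; lia.
  have -> : bump i j.-1.+1 = j.+1 by clear -ij; rewrite /bump; lia.
  by have -> : bump i j.-1 = j by clear -ij; rewrite /bump; lia.
have ij2 : (j.+1 < i)%N by clear -ij0 ij1 ij; lia.
apply/eqP; rewrite (@word_op_repeat m _ j) ?mulr0 //=; first by clear -ij2 im; lia.
have -> : bump i j.+1 = j.+1 by clear -ij2; rewrite /bump; lia.
by have -> : bump i j = j by clear -ij2; rewrite /bump; lia.
Qed.

Hypothesis UU : forall a n, \sum_(i < n.+1) (-1) ^+ (i * (n - i).+1) *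
   (U a i * U (a (+) odd i) (n - i)%N) = (n == 2%N)%:R.

(** For an alternating word, substitute [word_op + unitpart] for [U] in [UU]: the outer factors
    [dop] produce the differential, the units of degree 1 the two outer faces. Inner faces contain a
    repetition and vanish. *)
Lemma word_curvature0 n w : word_curvature n w = 0.
Proof.
have [alt|] := boolP (alternates n w); last exact: word_curvature_repeat.
set a := w 0%N; have walt j := alternates_odd alt (j := j).
have Wn : word_op n w = U a n - unitpart n by rewrite /word_op alt.
have Wp p : (p <= n)%N -> word_op p w = U a p - unitpart p.
  move=> pn; rewrite /word_op; case: alternatesP => // -[] j jp.
  have jn := leq_trans jp pn.
  by rewrite (walt j.+1) // (walt j) 1?ltnW //= addbN.
have Ws p : (p <= n)%N ->
    word_op (n - p) (w \o addn p) = U (a (+) odd p) (n - p) - unitpart (n - p).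
  move=> pn; rewrite /word_op; case: alternatesP => [_|[]].
    by rewrite /= addn0 walt.
  move=> j jp /=; have jn : (p + j < n)%N by rewrite -ltn_subRL.
  by rewrite addnS (walt _ jn) (walt _ (ltnW jn)) /= addbN.
rewrite /word_curvature.
(* The asymmetric expansion [(U - u) (U' - u') = U U' - u U' - (U - u) u'] avoids a separate product
   of unit parts. *)
have -> : \sum_(p < n.+1) (-1) ^+ (p * (n - p).+1) *
    (word_op p w * word_op (n - p) (w \o addn p)) =
    (n == 2%N)%:R
    - \sum_(p < n.+1) (-1) ^+ (p * (n - p).+1) * (unitpart p * U (a (+) odd p) (n - p)%N)
    - \sum_(p < n.+1) (-1) ^+ (p * (n - p).+1) * (word_op p w * unitpart (n - p)).
  rewrite -(UU a n) -!sumrB; apply: eq_bigr => p _.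
  rewrite -!mulrBr; congr (_ * _).
  rewrite Ws -1?ltnS // mulrBr; congr (_ - _).
  by rewrite Wp -1?ltnS // mulrBl.
case: n alt walt Wn Wp Ws => [|m] alt walt Wn Wp Ws.
  rewrite !big_ord1 /= !expr0 !mul1r addbF.
  have -> : U a 0%N = word_op 0 w + dop A by rewrite Wn subrK.
  by rewrite mulrDr dop2 !addr0 sub0r -opprD subrr.
have W0 : \sum_(i < m.+2) (-1) ^+ i * word_op m (w \o bump i) =
    U (~~ a) m - unitpart m + (-1) ^+ m.+1 * word_op m w.
  rewrite big_ord_recl big_ord_recr /= big1 ?add0r.
    rewrite expr0 mul1r; congr (_ + _ * _).
      have := Ws 1%N isT; rewrite subSS subn0 /= addbT => <-.
      by apply: word_op_eq => j _; rewrite /= /bump.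
    by apply: word_op_eq => j jm; rewrite /= /bump leqNgt ltnS jm.
  move=> i _; have im := ltn_ord i.
  rewrite (@word_op_repeat m _ i) ?mulr0 //=.
  have -> : bump (bump 0 i) i.+1 = i.+2 by rewrite /bump; clear; lia.
  have -> : bump (bump 0 i) i = i by rewrite /bump; clear; lia.
  by rewrite (walt i.+2) // (walt i) /= ?negbK // ltnW // ltnW.
rewrite W0 mulrDr mulrA -exprD addnn -[(-1) ^+ _.*2]signr_odd odd_double expr0 mul1r.
(* [unitpart] vanishes above degree 1, so only the last two splittings remain here and the first two
   in the next sum. *)
have -> : \sum_(p < m.+2) (-1) ^+ (p * (m.+1 - p).+1) * (word_op p w * unitpart (m.+1 - p)) =
    word_op m w + (-1) ^+ m.+1 * (word_op m.+1 w * dop A).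
  rewrite !big_ord_recr /= subnn subSnn muln1 muln2 -[(-1) ^+ _.*2]signr_odd odd_double expr0 mul1r mulr1.
  rewrite big1 ?add0r // => p _; rewrite subSn; last exact: ltnW.
  by rewrite /= subn_eq0 leqNgt ltn_ord !mulr0.
have -> : \sum_(p < m.+2) (-1) ^+ (p * (m.+1 - p).+1) * (unitpart p * U (a (+) odd p) (m.+1 - p)%N) =
    dop A * U a m.+1 + (-1) ^+ m.+1 * U (~~ a) m.
  rewrite !big_ord_recl /= expr0 !mul1r addbF addbT subSS !subn0 mul1n.
  by rewrite big1 ?addr0 // => p _; rewrite mul0r mulr0.
have -> : dop A * U a m.+1 = dop A * word_op m.+1 w + dop A * unitpart m.+1.
  by rewrite Wn mulrBr subrK.
rewrite mulrBr !opprD !addrA.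
rewrite [LHS](ACl ((1*7)*(2*11)*(3*9)*(5*10)*(6*8*4)))%AC /= !subrr !add0r.
(* What is left cancels: two copies of [dop] for words with two letters, and for three letters a
   unit against the right side of [UU]. *)
case: m {alt walt Wn Wp Ws W0} => [|[|m]] /=.
- by rewrite mulr1 expr1 mulN1r opprK add0r addNr.
- by rewrite mulr0 subr0 sqrrN expr1n mul1r subrr.
- by rewrite !mulr0 !subr0.
Qed.

End Words.

Section OpEquiv.
Variables (k : comPzRingType) (A : dga k).

(** * The two implications *)

Definition op_equiv (D : bool -> op A) := exists F h : bool -> op A,
  [/\ forall a, homog 0 (F a), forall a, homog (-1) (h a),
      forall a, D a * F a = F a * D (~~ a) &
      forall a, D a * h a + h a * D a = 1 - F a * F (~~ a)].

Lemma bump_leq m i j : (j <= m)%N -> (bump i j <= m.+1)%N.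
Proof. by rewrite /bump; lia. Qed.

Lemma affine_eq n w w' : word_eq n w w' -> affine n w = affine n w'.
Proof.
move=> ww; rewrite /affine; congr restr; apply/funext => t.
by apply: eq_bigr => j _; rewrite ww // -ltnS.
Qed.

Lemma face_affine m (i : 'I_m.+2) w : face i (affine m.+1 w) = affine m (w \o bump i).
Proof. by rewrite face_push affine_push // => j; apply: bump_leq. Qed.

Lemma front_affine n p w : (p <= n)%N -> front n p (affine n w) = affine p w.
Proof.
by move=> pn; rewrite front_push // affine_push // => j jp; apply: leq_trans pn.
Qed.

Lemma back_affine n p w : (p <= n)%N ->
  back n (n - p) (affine n w) = affine (n - p) (w \o addn p).
Proof.
move=> pn; rewrite back_push ?leq_subr // subKn // affine_push // => j.
by rewrite leq_subRL.
Qed.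

Definition alt_word (a : bool) (j : nat) : bool := a (+) odd j.

(** The equations on alternating edges and triangles are the two relations wanted. The outer faces
    of a triangle supply the linear terms of the product of [1 + X] on its two edges. *)
Lemma strongly_homotopic_op_equiv (x0 x1 : A 1) : strongly_homotopic x0 x1 ->
  op_equiv (fun a => MCop (if a then x1 else x0)).
Proof.
move=> [X [Xn [X0 X1] e0 e1]].
pose xi n w := lmulop (X n (affine n w)).
have xiD a : MCop (if a then x1 else x0) = dop A + xi 0%N (alt_word a).
  congr (_ + _); rewrite /xi affine_vertex /alt_word addbF -e0 -e1.
  by case: a; rewrite lmulop_castd // subr0.
have xi_eq n w w' : word_eq n w w' -> xi n w = xi n w'.
  by move=> ww; rewrite /xi (affine_eq ww).
have xiMC m w : dop A * xi m.+1 w + (-1) ^+ m.+1 * (xi m.+1 w * dop A) +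
    (-1) ^+ m.+1 * (\sum_(i < m.+2) (-1) ^+ i * xi m (w \o bump i)) +
    \sum_(p < m.+2) (-1) ^+ (p * (m.+1 - p).+1) *
       (xi p w * xi (m.+1 - p)%N (w \o addn p)) = 0.
  have := congr1 (@lmulop _ A _) (X1 m _ (affine_sing m.+1 w)).
  rewrite !lmulopD lmulop0 lmulop_dgd lmulop_cobd lmulop_sq => E; rewrite -[RHS]E.
  congr (_ + _ * _ + _); apply: eq_bigr => i _; first by rewrite face_affine.
  by rewrite front_affine ?back_affine // -ltnS.
have {}X1 a : dop A * xi 1%N (alt_word a) - xi 1%N (alt_word a) * dop A
    - (xi 0%N (alt_word (~~ a)) - xi 0%N (alt_word a))
    + (xi 0%N (alt_word a) * xi 1%N (alt_word a)
       - xi 1%N (alt_word a) * xi 0%N (alt_word (~~ a))) = 0.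
  rewrite -[RHS](xiMC 0%N (alt_word a)) !big_ord_recl !big_ord0 /=.
  rewrite !expr0 !expr1 !mulN1r !mul1r !addr0.
  congr (_ - (_ - _) + (_ - _ * _)); apply: xi_eq => -[|j] // _;
    by rewrite /alt_word /= ?addbN ?addbF ?addbT.
have {}X2 a : dop A * xi 2%N (alt_word a) + xi 2%N (alt_word a) * dop A
    + (xi 1%N (alt_word (~~ a)) + xi 1%N (alt_word a))
    + (xi 0%N (alt_word a) * xi 2%N (alt_word a)
       + xi 1%N (alt_word a) * xi 1%N (alt_word (~~ a))
       + xi 2%N (alt_word a) * xi 0%N (alt_word a)) = 0.
  rewrite -[RHS](xiMC 1%N (alt_word a)) !big_ord_recl !big_ord0 /=.
  rewrite -![bump 0 0]/1%N -![bump 0 1]/2%N.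
  rewrite -[(-1) ^+ (1 * (2 - 1).+1)]/((-1) ^+ 2) -[(-1) ^+ (2 * (2 - 2).+1)]/((-1) ^+ 2).
  rewrite !sqrrN !expr1n !expr0 !expr1 !mulN1r !mul1r !addr0.
  (* The inner face spells [a a]; it is degenerate, so normalization kills it. *)
  have -> : xi 1%N (alt_word a \o bump 1) = 0.
    rewrite /xi Xn ?lmulop0 //; first exact: affine_sing.
    by apply: (@affine_degenerate _ _ ord0); rewrite /alt_word /= addbF.
  rewrite oppr0 add0r -!addrA.
  congr (_ + (_ + (_ + (_ + (_ + (_ * _ + _ * _))))));
    apply: xi_eq => -[|[|j]] // _;
    by rewrite /alt_word /= ?addbN ?addbF ?addbT ?addNb ?negbK.
exists (fun a => 1 + xi 1%N (alt_word a)), (fun a => xi 2%N (alt_word a)).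
split=> a.
- by apply: homogD; [exact: homog1|apply: homog_lmulop].
- exact: homog_lmulop.
- rewrite !xiD !mulrDl !mulrDr !mulr1 !mul1r.
  apply/eqP; rewrite -subr_eq0 -[eqbRHS](X1 a); apply/eqP.
  rewrite !opprD !opprK !addrA.
  by rewrite [LHS](ACl ((1*5)*2*7*6*3*4*8))%AC /= subrr add0r.
- rewrite !xiD !mulrDl !mulrDr !mul1r !mulr1.
  apply/eqP; rewrite -subr_eq0 -[eqbRHS](X2 a); apply/eqP.
  rewrite !opprD !opprK !addrA.
  by rewrite [LHS](ACl ((5*6)*1*3*7*8*2*9*4))%AC /= addNr add0r.
Qed.

(** * Right linear maps of twisted modules as operators *)

Lemma single_twd (x : A 1) n (a : A n) : single (twd x a) = MCop x (single a).
Proof.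
rewrite /twd singleD -dop_single single_castd; last by rewrite addrC.
by rewrite -lmulop_single.
Qed.

(** A right linear map is left multiplication by its value at the unit. The shift [g] covers
    morphisms and homotopies alike. *)
Lemma single_linear_map g (phi : forall n, A n -> A (g n)) :
  (forall n m, g (n + m) = g n + m) ->
  (forall n m (a : A n) (b : A m),
     phi (n + m) (dgmul A a b) = castd (dgmul A (phi n a) b)) ->
  forall n (a : A n), single (phi n a) = lmulop (phi 0 (dgone A)) (single a).
Proof.
move=> gD phiM n a; rewrite lmulop_single -{1}(dgmul1l a).
rewrite (castd_app phi) ?add0r // single_castd; last by rewrite add0r.
by rewrite phiM single_castd.
Qed.

Lemma dgmod_hom_op (x y : A 1) f : dgmod_hom x y f ->
  exists2 F, homog 0 F & MCop y * F = F * MCop x /\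
    forall n (a : A n), single (f n a) = F (single a).
Proof.
move=> [_ [fM fd]]; exists (lmulop (f 0 (dgone A))); first exact: homog_lmulop.
have fS := @single_linear_map id f (fun _ _ => erefl)
  (fun n m a b => etrans (fM n m a b) (esym (castd_id _))).
split=> //; apply/eqP; rewrite -subr_eq0; apply/eqP.
set F := lmulop _; apply: (@homog_eq0 _ _ 1).
  (* The terms with [dop] combine into multiplication by a differential, so the defect is
     homogeneous and need only be tested at the unit. *)
  have -> : MCop y * F - F * MCop x =
      lmulop (dgd A (f 0 (dgone A))) + (lmulop y * F - F * lmulop x).
    rewrite /MCop mulrDl mulrDr lmulop_d expr0 mul1r opprD !addrA.
    by rewrite [LHS](ACl (1*3*5*(2*4)))%AC /= subrr addr0.
  apply: homogD; first exact: homog_lmulop.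
  by apply: homogD; [|apply: homogN]; rewrite -lmulopM; apply: homog_lmulop.
apply: famP => n; rewrite opDE opNE !opME -single_twd -!fS fd single_twd.
exact: subrr.
Qed.

Lemma dgmod_htpy_single (x : A 1) n (a b : A n) (c : A (n - 1)) (e : A (n + 1 - 1)) :
  b - a = castd (twd x c) + castd e <->
  fadd (single b) ((- 1 : op A) (single a)) = fadd (MCop x (single c)) (single e).
Proof.
have -> : (- 1 : op A) (single a) = single (- a).
  by apply: famP => m; rewrite opNE op1E /single -[in RHS]scaleN1r castdZ scaleN1r.
rewrite -single_twd -(@single_castd _ _ (n - 1 + 1) n) ?subrK //.
rewrite -(@single_castd _ _ (n + 1 - 1) n) ?addrK // -!singleD.
by split=> [->|/single_inj].
Qed.

Lemma dgmod_htpy_op (x : A 1) u h G : homog 0 G ->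
  (forall n (a : A n), single (u n a) = G (single a)) -> dgmod_htpy x u h ->
  exists2 H, homog (-1) H & MCop x * H + H * MCop x = 1 - G.
Proof.
move=> hG uS [_ [hM hd]].
pose H := lmulop (h 0 (dgone A)).
have hS := single_linear_map (fun n m => addrAC n m (-1)) hM.
(* [dgmod_htpy] has [u - id] where [1 - G] is wanted, hence the sign. *)
exists (- H); first by apply: homogN; apply: homog_lmulop; rewrite sub0r.
rewrite mulrN mulNr -opprD -[RHS]opprB; congr (- _).
apply/eqP; rewrite -subr_eq0; apply/eqP; apply: (@homog_eq0 _ _ 0).
  apply: homogD; last by apply/homogN/homogD => //; apply/homogN/homog1.
  have -> : MCop x * H + H * MCop x =
      lmulop (dgd A (h 0 (dgone A))) + (lmulop x * H + H * lmulop x).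
    rewrite /MCop mulrDl mulrDr lmulop_d expr1 mulN1r !addrA.
    by rewrite [LHS](ACl (1*3*5*(2*4)))%AC /= addNr addr0.
  apply: homogD; first exact: homog_lmulop.
  by apply: homogD; rewrite -lmulopM; apply: homog_lmulop.
have /dgmod_htpy_single := hd 0 (dgone A).
rewrite uS !hS single_twd => E.
have {}E : (G - 1) (single (dgone A)) = (MCop x * H + H * MCop x) (single (dgone A)).
  exact: E.
by apply: famP => n; rewrite opDE opNE -E subrr.
Qed.

Lemma hge_op_equiv (x0 x1 : A 1) : homotopy_gauge_equivalent x0 x1 ->
  op_equiv (fun a => MCop (if a then x1 else x0)).
Proof.
move=> [f [g [h [h' [/dgmod_hom_op[F F0 [DF fS]] /dgmod_hom_op[G G0 [DG gS]] hh hh']]]]].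
have [|n a|H H1 DH] := dgmod_htpy_op (G := G * F) _ _ hh.
- exact: homogM G0 F0 _.
- by rewrite gS fS.
have [|n a|H' H1' DH'] := dgmod_htpy_op (G := F * G) _ _ hh'.
- exact: homogM F0 G0 _.
- by rewrite fS gS.
by exists (fun a => if a then F else G), (fun a => if a then H' else H); split; case.
Qed.

Lemma op_dgmod_hom (x y : A 1) (a : A 0) : MCop y * lmulop a = lmulop a * MCop x ->
  dgmod_hom x y (fun n b => castd (dgmul A a b)).
Proof.
move=> E; have aS n (b : A n) : single (castd (dgmul A a b) : A n) = lmulop a (single b).
  by rewrite single_castd ?add0r // lmulop_single.
split; [|split] => [n r b c|n m b c|n b].
- by rewrite dgmul_linr castdD castdZ.
- apply: single_inj; rewrite aS -!lmulop_single lmulop_castd ?add0r //.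
  by rewrite lmulopM.
- by apply: single_inj; rewrite aS !single_twd aS -!opME E.
Qed.

Lemma op_dgmod_htpy (x : A 1) (u : forall n, A n -> A n) (a : A (-1)) (G : op A) :
  (forall n (b : A n), single (u n b) = G (single b)) ->
  MCop x * lmulop a + lmulop a * MCop x = G - 1 ->
  dgmod_htpy x u (fun n b => castd (dgmul A a b)).
Proof.
move=> uS E.
have aS n (b : A n) : single (castd (dgmul A a b) : A (n - 1)) = lmulop a (single b).
  by rewrite single_castd ?lmulop_single // addrC.
split; [|split] => [n r b c|n m b c|n b].
- by rewrite dgmul_linr castdD castdZ.
- apply: single_inj; rewrite aS single_castd; last by rewrite addrAC.
  by rewrite -!lmulop_single lmulop_castd ?lmulopM // addrC.
- apply/dgmod_htpy_single; rewrite uS !aS single_twd.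
  exact: (congr1 (fun w : op A => w (single b)) (esym E)).
Qed.

Lemma op_equiv_hge (x0 x1 : A 1) : op_equiv (fun a => MCop (if a then x1 else x0)) ->
  homotopy_gauge_equivalent x0 x1.
Proof.
move=> [F [h [F0 h1 DF Dh]]].
have [f fE] := F0 true; have [g gE] := F0 false.
have [a aE] := homogN (h1 false); have [b bE] := homogN (h1 true).
have fgS c d n (y : A n) :
    single (castd (dgmul A (c : A 0) (castd (dgmul A (d : A 0) y) : A n)) : A n) =
    (lmulop c * lmulop d) (single y).
  by rewrite single_castd ?add0r // -lmulop_single single_castd ?add0r // -lmulop_single.
exists (fun n y => castd (dgmul A f y)), (fun n y => castd (dgmul A g y)),
  (fun n y => castd (dgmul A a y)), (fun n y => castd (dgmul A b y)).
split.
- by apply: op_dgmod_hom; rewrite -fE; exact: (DF true).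
- by apply: op_dgmod_hom; rewrite -gE; exact: (DF false).
- by apply: (op_dgmod_htpy (fgS g f)); rewrite -aE -fE -gE mulrN mulNr -opprD (Dh false) opprB.
- by apply: (op_dgmod_htpy (fgS f g)); rewrite -bE -fE -gE mulrN mulNr -opprD (Dh true) opprB.
Qed.

(** * A cochain from the labels of vertices *)

Definition labels n (s : 'rV[RR]_n.+1 -> RR) (j : nat) : bool := s (stdvertex n j) == 1.

(** Vertices go to vertices under [push], so labels are compatible with faces, degeneracies, and
    front and back parts. *)
Lemma labels_push m n phi s : (forall j, (j <= m)%N -> (phi j <= n)%N) ->
  word_eq m (labels (restr (s \o push m n phi))) (labels s \o phi).
Proof.
move=> phin j jm; rewrite /labels restrE; last exact: stdvertex_simplex.
by rewrite /= push_stdvertex.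
Qed.

Lemma op_equiv_strongly_homotopic (x0 x1 : A 1) : is_MC x0 -> is_MC x1 ->
  op_equiv (fun a => MCop (if a then x1 else x0)) -> strongly_homotopic x0 x1.
Proof.
move=> /is_MC_op DD0 /is_MC_op DD1 [F [h [F0 h1 DF Dh]]].
have [|U [U0 Uh UU]] := coherent_tower
  (D := fun a => MCop (if a then x1 else x0)) (F0 false) (F0 true) (h1 false) (h1 true) _
  (DF false) (DF true) (Dh false) (Dh true); first by case.
(* Removing the differential and the unit leaves genuine elements of [A], of the degree required of
   a cochain. *)
have Wex a n : exists x : A (1 - n%:Z), lmulop x = U a n - unitpart A n.
  case: n => [|n].
    exists (castd (if a then x1 else x0)).
    by rewrite lmulop_castd ?subr0 // U0 /MCop addrC addrA addNr add0r.
  suff [x ->] : homog (1 - n.+1%:Z) (U a n.+1 - unitpart A n.+1) by exists x.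
  apply: homogD; first by have := Uh a n; congr (homog _ _); lia.
  apply: homogN; case: n => [|n]; [exact: homog1|exact: homog0].
pose W a n := projT1 (cid (Wex a n)).
have WE a n : lmulop (W a n) = U a n - unitpart A n by exact: projT2 (cid (Wex a n)).
pose X : cochain1 A := fun n s => if alternates n (labels s) then W (labels s 0%N) n else 0.
have XE n s : lmulop (X n s) = word_op U n (labels s).
  by rewrite /X /word_op; case: ifP => _; rewrite ?WE ?lmulop0.
have XF m (i : 'I_m.+2) s : lmulop (X m (face i s)) = word_op U m (labels s \o bump i).
  rewrite XE face_push; apply/word_op_eq/labels_push => j; exact: bump_leq.
have XS n (s : 'rV[RR]_n.+1 -> RR) (p : 'I_n.+1) :
    lmulop (X p (front n p s)) * lmulop (X (n - p)%N (back n (n - p) s)) =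
    word_op U p (labels s) * word_op U (n - p) (labels s \o addn p).
  have pn : (p <= n)%N by rewrite -ltnS.
  rewrite !XE front_push // back_push ?leq_subr // subKn //; congr (_ * _).
    by apply/word_op_eq/labels_push => j jp; apply: leq_trans pn.
  by apply/word_op_eq/labels_push => j; rewrite leq_subRL.
exists X; split.
- move=> m s _ [j [tau [_ ->]]]; apply: (@lmulop_inj _ A); rewrite XE lmulop0.
  have jm := ltn_ord j.
  have -> : codeg j = push m.+1 m (unbump j) by apply/funext => t; rewrite codeg_push.
  have un l : (l <= m.+1)%N -> (unbump j l <= m)%N by clear -jm; rewrite /unbump; lia.
  rewrite (word_op_eq _ (labels_push tau un)).
  (* The vertices [j] and [j + 1] of the degenerate simplex have the same image, so its label word
     has a repetition. *)
  apply: (@word_op_repeat _ _ _ _ _ j) => //=.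
  by congr labels; rewrite /unbump ltnn ltnSn subn0 subn1.
(* Injectivity of [lmulop] reduces both equations to [word_curvature0] for the label word. *)
- split=> [s _|m s _]; apply: (@lmulop_inj _ A).
    rewrite lmulopD lmulop0 lmulop_dgd lmulop_sq.
    under eq_bigr do rewrite XS.
    rewrite XE -[RHS](word_curvature0 UU 0 (labels s)) /word_curvature.
    by rewrite addr0.
  rewrite !lmulopD lmulop0 lmulop_dgd lmulop_cobd lmulop_sq.
  under [in X in _ + X]eq_bigr do rewrite XS.
  under [in X in _ + X + _]eq_bigr do rewrite XF.
  by rewrite XE -[RHS](word_curvature0 UU m.+1 (labels s)).
- apply: (@lmulop_inj _ A); rewrite lmulop_castd ?subr0 // XE /word_op.
  rewrite (_ : labels _ _ = false).
    by case: alternatesP => [_|[]//]; rewrite U0 /MCop addrC addrA addNr add0r.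
  rewrite /labels /vertex restrE; last exact: stdvertex_simplex.
  by rewrite eq_sym (negbTE (oner_neq0 RR)).
- apply: (@lmulop_inj _ A); rewrite lmulop_castd ?subr0 // XE /word_op.
  rewrite (_ : labels _ _ = true).
    by case: alternatesP => [_|[]//]; rewrite U0 /MCop addrC addrA addNr add0r.
  rewrite /labels /vertex restrE; last exact: stdvertex_simplex.
  exact: eqxx.
Qed.

End OpEquiv.

Theorem theorem5p8 (k : comPzRingType) (A : dga k) (x0 x1 : A 1) :
  is_MC x0 -> is_MC x1 ->
  (strongly_homotopic x0 x1 <-> homotopy_gauge_equivalent x0 x1).
Proof.
move=> mc0 mc1; split=> [/strongly_homotopic_op_equiv/op_equiv_hge //|/hge_op_equiv].
exact: op_equiv_strongly_homotopic.
Qed.
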